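(* Let $q\ge 5$ be a prime power. In $\mathrm{AG}(2,q)$ there exists a minimal blocking set of size $k$ for every integer $k$ with $2q-1\le k\le 3q-6$.
   Context: $\mathrm{AG}(2,q)$ is the affine plane of order $q$. A blocking set of $\mathrm{AG}(2,q)$ is a set of points meeting every line of $\mathrm{AG}(2,q)$ (it may contain lines); it is minimal if no proper subset is a blocking set. *)

(* Defs.v *)
From mathcomp Require Import all_boot all_order all_algebra.

Set Implicit Arguments.
Unset Strict Implicit.
Unset Printing Implicit Defensive.

Import GRing.Theory.
Local Open Scope ring_scope.

(* AG(2,q) is the Desarguesian plane over the field F with q elements: its
   points are the vectors of 'rV[F]_2 and its lines the cosets of the
   one-dimensional subspaces. *)
Definition affine_line (F : finFieldType) (a v : 'rV[F]_2) : {set 'rV[F]_2} :=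
  [set a + t *: v | t : F].

Definition lines (F : finFieldType) : {set {set 'rV[F]_2}} :=
  [set affine_line a v | a in [set: 'rV[F]_2], v in [set~ 0]].

Definition blocking_set (F : finFieldType) (B : {set 'rV[F]_2}) : bool :=
  [forall L in lines F, B :&: L != set0].

Definition minimal_blocking_set (F : finFieldType) (B : {set 'rV[F]_2}) : bool :=
  blocking_set B && [forall (C : {set 'rV[F]_2} | C \proper B), ~~ blocking_set C].

(* Main.v *)
(* Let C be a set of m field elements avoiding 0 and 1, and take the points
   (x, 0) with x <> 0, (0, y) with y in C, (1, y) with y not in C, and (x, 1)
   with 1/x in C: 2q - 2 + m points in all, meeting every line.  The points off
   the x-axis always have a tangent, horizontal or through the origin.  The
   point (x, 0) has the vertical tangent if w := 1/x is not in C (the line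
   X + Y = 1 if x = 1); otherwise the line joining it to (0, e) is tangent as
   soon as e (1 - w) is in C while e and w e / (e - 1) are not.
   For m = 1 take C = {w} and e = w / (1 - w).  If C is stable under
   w |-> 1 - w, then e = 1 works, which gives every even m; for odd m >= 3 add
   the fixed point 1/2 in odd characteristic, and in characteristic 2 add
   s + 1, s^2 and s^2 + 1 to a stable set, where s is not in C and e = s serves
   w = s + 1. *)
Require Import Defs.
From mathcomp Require Import all_boot all_order all_algebra.
From mathcomp Require Import ring zify.

Set Implicit Arguments.
Unset Strict Implicit.
Unset Printing Implicit Defensive.

Import GRing.Theory.
Local Open Scope ring_scope.

(** * Points and lines in coordinates *)

Definition point (F : finFieldType) (x y : F) : 'rV[F]_2 :=
  \row_(j < 2) (if j == 0 then x else y).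

Lemma pointE (F : finFieldType) (x y : F) :
  (point x y 0 0 = x) * (point x y 0 1 = y).
Proof. by rewrite !mxE. Qed.

Lemma point_eta (F : finFieldType) (z : 'rV[F]_2) : z = point (z 0 0) (z 0 1).
Proof.
apply/rowP=> j; rewrite mxE; case: eqP => [-> // | /eqP j_neq0].
by congr (z 0 _); apply/val_inj; case: j j_neq0 => [[|[|]]].
Qed.

Lemma eq_point (F : finFieldType) (x y x' y' : F) :
  (point x y == point x' y') = (x == x') && (y == y').
Proof.
apply/eqP/andP=> [/rowP e | [/eqP-> /eqP->] //].
by have := e 0; have := e 1; rewrite !pointE => -> ->.
Qed.

Lemma horizontal_line (F : finFieldType) (c : F) :
  exists2 L, L \in lines F & forall x y, (point x y \in L) = (y == c).
Proof.
exists (affine_line (point 0 c) (point 1 0)).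
  apply/imset2P; exists (point 0 c) (point 1 0); rewrite ?inE //.
  by apply/eqP=> /rowP/(_ 0)/eqP; rewrite !mxE oner_eq0.
move=> x y; apply/imsetP/eqP=> [[t _ /rowP/(_ 1)] | ->].
  by rewrite !mxE /= mulr0 addr0.
by exists x => //; apply/rowP=> j; rewrite !mxE; case: eqP;
  rewrite ?mulr1 ?mulr0 ?add0r ?addr0.
Qed.

(** Taking the second coordinate as parameter reaches every direction except the horizontal one;
    [u = 0] gives the vertical lines. *)
Lemma oblique_line (F : finFieldType) (a u : F) :
  exists2 L, L \in lines F & forall x y, (point x y \in L) = (x == a + u * y).
Proof.
exists (affine_line (point a 0) (point u 1)).
  apply/imset2P; exists (point a 0) (point u 1); rewrite ?inE //.
  by apply/eqP=> /rowP/(_ 1)/eqP; rewrite !mxE oner_eq0.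
move=> x y; apply/imsetP/eqP=> [[t _ e] | ->].
  move/rowP: e => e; have := e 0; have := e 1; rewrite !mxE /= => -> ->.
  by rewrite mulr1 add0r mulrC.
exists y => //; apply/rowP=> j; rewrite !mxE.
by case: eqP; rewrite ?mulr1 ?add0r // mulrC.
Qed.

Lemma lines_cases (F : finFieldType) (L : {set 'rV[F]_2}) : L \in lines F ->
  (exists c, forall x, point x c \in L) \/
  (exists a u, forall y, point (a + u * y) y \in L).
Proof.
case/imset2P=> b v _; rewrite !inE => v_neq0 ->.
have [v1_0 | v1_neq0] := eqVneq (v 0 1) 0.
  have v0_neq0 : v 0 0 != 0.
    apply: contra_neq v_neq0 => v0_0; apply/rowP=> j.
    by rewrite [v]point_eta v0_0 v1_0 !mxE if_same.
  left; exists (b 0 1) => x; apply/imsetP; exists ((x - b 0 0) / v 0 0) => //.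
  apply/eqP; rewrite [_ + _]point_eta eq_point !mxE v1_0 mulr0 addr0 eqxx andbT.
  by rewrite divfK // addrC subrK.
right; exists (b 0 0 - v 0 0 / v 0 1 * b 0 1), (v 0 0 / v 0 1) => y.
apply/imsetP; exists ((y - b 0 1) / v 0 1) => //.
apply/eqP; rewrite [in X in _ == X](point_eta (_ + _)) eq_point !mxE.
by apply/andP; split; apply/eqP; field.
Qed.

(** A proper subset omits some point [z] of [B] and therefore misses the tangent line at [z]. *)
Lemma tangents_minimal (F : finFieldType) (B : {set 'rV[F]_2}) :
  blocking_set B ->
  (forall z, z \in B -> exists2 L, L \in lines F & B :&: L \subset [set z]) ->
  minimal_blocking_set B.
Proof.
move=> B_blocking tangent; rewrite /minimal_blocking_set B_blocking /=.
apply/forall_inP=> C /properP[CB [z zB zC]].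
have [L L_line BL] := tangent z zB.
apply/forall_inPn; exists L; rewrite // negbK -subset0.
apply/subsetP=> x /setIP[xC xL].
have := subsetP BL x; rewrite !inE xL (subsetP CB) // => /(_ isT)/eqP xz.
by rewrite -xz xC in zC.
Qed.

(** * The point set on four lines: size, blocking, minimality *)

(* The last clause excludes x = 0 as long as 0 is not in C, because 0^-1 = 0. *)
Definition four_line_set (F : finFieldType) (C : {set F}) : {set 'rV[F]_2} :=
  [set z : 'rV[F]_2 | [|| (z 0 1 == 0) && (z 0 0 != 0),
    (z 0 0 == 0) && (z 0 1 \in C),
    (z 0 0 == 1) && (z 0 1 \notin C)
  | (z 0 1 == 1) && ((z 0 0)^-1 \in C)]].

Lemma in_four_line_set (F : finFieldType) (C : {set F}) x y :
  (point x y \in four_line_set C) =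
  [|| (y == 0) && (x != 0), (x == 0) && (y \in C), (x == 1) && (y \notin C)
    | (y == 1) && (x^-1 \in C)].
Proof. by rewrite inE !pointE. Qed.

(** The point (1, 0) satisfies both the first and the third clause. Counting it in [A1] only makes
    the pieces disjoint, of sizes q - 1, m, q - 1 - m and m, where m is the size of [C]. *)
Lemma card_four_line_set (F : finFieldType) (C : {set F}) :
  0 \notin C -> 1 \notin C -> #|four_line_set C| = (2 * #|F| - 2 + #|C|)%N.
Proof.
move=> C0 C1.
pose A1 : {set 'rV[F]_2} := [set point x 0 | x in [set~ (0 : F)]].
pose A2 : {set 'rV[F]_2} := [set point 0 y | y in C].
pose A3 : {set 'rV[F]_2} := [set point 1 y | y in ~: (0 |: C)].
pose A4 : {set 'rV[F]_2} := [set point x^-1 1 | x in C].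
have memA x y : (((point x y \in A1) = (y == 0) && (x != 0)) *
  ((point x y \in A2) = (x == 0) && (y \in C)) *
  ((point x y \in A3) = (x == 1) && ((y != 0) && (y \notin C))) *
  ((point x y \in A4) = (y == 1) && (x^-1 \in C)))%type.
  split; [split; [split |] |].
  - apply/imsetP/andP=> [[t] | [/eqP-> x0]]; last by exists x; rewrite ?inE.
    by rewrite !inE => t0 /eqP; rewrite eq_point => /andP[/eqP-> ->].
  - apply/imsetP/andP=> [[t tC /eqP] | [/eqP-> yC]]; last by exists y.
    by rewrite eq_point => /andP[-> /eqP->].
  - apply/imsetP/andP=> [[t] | [/eqP-> y0]].
      by rewrite !inE negb_or => t0 /eqP; rewrite eq_point => /andP[-> /eqP->].
    by exists y; rewrite // !inE negb_or.
  apply/imsetP/andP=> [[t tC /eqP] | [/eqP-> xC]].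
    by rewrite eq_point => /andP[/eqP-> ->]; rewrite invrK.
  by exists x^-1; rewrite // invrK.
have -> : four_line_set C = A1 :|: (A2 :|: (A3 :|: A4)).
  apply/setP=> z; rewrite [z]point_eta; set x := z 0 0; set y := z 0 1.
  rewrite in_four_line_set !in_setU !memA.
  have [-> | _] := eqVneq x 1; last by [].
  by have [-> | _] := eqVneq y 0; rewrite ?oner_eq0 ?C0.
have dis (X Y : {set 'rV[F]_2}) :
    (forall x y, point x y \in X -> point x y \notin Y) -> X :&: Y = set0.
  move=> XY; apply/eqP; rewrite setI_eq0; apply/pred0P=> z /=; apply/negP.
  by rewrite [z]point_eta => /andP[/XY/negbTE->].
have dis1 : A1 :&: (A2 :|: (A3 :|: A4)) = set0.
  apply: dis => x y; rewrite !in_setU !memA.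
  by case/andP=> /eqP-> x0; rewrite (negbTE C0) eqxx !andbF eq_sym oner_eq0.
have dis2 : A2 :&: (A3 :|: A4) = set0.
  apply: dis => x y; rewrite !in_setU !memA.
  case/andP=> /eqP-> yC; rewrite eq_sym oner_eq0 invr0 (negbTE C0).
  by rewrite andbF.
have dis3 : A3 :&: A4 = set0.
  apply: dis => x y; rewrite !memA.
  by case/andP=> /eqP-> _; rewrite invr1 (negbTE C1) andbF.
rewrite !cardsU dis1 dis2 dis3 cards0 !subn0.
rewrite (card_imset _ (_ : injective (fun x => point x 0))); last first.
  by move=> x y /eqP; rewrite eq_point eqxx andbT => /eqP.
rewrite (card_imset _ (_ : injective (point 0))); last first.
  by move=> x y /eqP; rewrite eq_point => /andP[_ /eqP].
rewrite (card_imset _ (_ : injective (point 1))); last first.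
  by move=> x y /eqP; rewrite eq_point => /andP[_ /eqP].
rewrite (card_imset _ (_ : injective (fun x => point x^-1 1))); last first.
  by move=> x y /eqP; rewrite eq_point eqxx andbT => /eqP/invr_inj.
rewrite cardsC1.
have := cardsC (0 |: C); rewrite cardsU1 C0 /= => e.
by rewrite -{}e; move: #|~: _| #|C| => m m'; lia.
Qed.

(** A horizontal line Y = c is met at (0, c) or (1, c), and any other line avoiding the origin at
    its point on the x-axis. Through the origin, the y-axis is met because [C] is nonempty, and X =
    u Y at (u, 1) or (1, 1/u). *)
Lemma four_line_set_blocking (F : finFieldType) (C : {set F}) :
  0 \notin C -> C != set0 -> blocking_set (four_line_set C).
Proof.
move=> C0 /set0Pn[w wC]; apply/forall_inP=> L L_line.
suff [x [y [xyB xyL]]] :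
    exists x y, point x y \in four_line_set C /\ point x y \in L.
  by apply/set0Pn; exists (point x y); apply/setIP.
case: (lines_cases L_line) => [[c cL] | [a [u auL]]].
  have [cC | cC] := boolP (c \in C).
    by exists 0, c; rewrite cL in_four_line_set cC eqxx /= !orbT.
  by exists 1, c; rewrite cL in_four_line_set cC eqxx /= !orbT.
have [a0 | a_neq0] := eqVneq a 0; last first.
  exists a, 0; have := auL 0; rewrite mulr0 addr0 => ->.
  by rewrite in_four_line_set eqxx a_neq0.
have {}auL y : point (u * y) y \in L by have := auL y; rewrite a0 add0r.
have [u0 | u_neq0] := eqVneq u 0.
  exists 0, w; have := auL w; rewrite u0 mul0r => ->.
  by rewrite in_four_line_set eqxx wC orbT.
have [uC | uC] := boolP (u^-1 \in C).
  exists u, 1; have := auL 1; rewrite mulr1 => ->.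
  by rewrite in_four_line_set eqxx uC !orbT.
exists 1, u^-1; have := auL u^-1; rewrite divff // => ->.
by rewrite in_four_line_set eqxx uC !orbT.
Qed.

(** The condition on [e] serves the points (x, 0) with w = 1/x in [C], whose vertical line also
    contains (x, 1). The line from (x, 0) to (0, e) crosses X = 1 at height e (1 - w), and Y = 1 at
    an abscissa with inverse w e / (e - 1). *)
Lemma four_line_set_minimal (F : finFieldType) (C : {set F}) :
  0 \notin C -> 1 \notin C -> C != set0 ->
  (forall w, w \in C -> exists e,
     [/\ e != 0, e \notin C, e * (1 - w) \in C & w * e / (e - 1) \notin C]) ->
  minimal_blocking_set (four_line_set C).
Proof.
move=> C0 C1 C_neq0 C_tangent.
apply: tangents_minimal; first exact: four_line_set_blocking.
suff tangent (x y : F) : point x y \in four_line_set C ->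
  exists2 L, L \in lines F &
    forall x' y', point x' y' \in four_line_set C -> point x' y' \in L ->
    x' = x /\ y' = y.
  move=> z; rewrite [z]point_eta => /tangent[L L_line LP]; exists L => //.
  apply/subsetP=> z' /setIP[]; rewrite [z']point_eta => zB zL.
  by have [-> ->] := LP _ _ zB zL; rewrite inE.
(* The point (1, 0) comes up under two clauses. The line X + Y = 1 meets both X = 0 and Y = 1 in (0,
   1), which is not in the set. *)
have tangent10 : exists2 L, L \in lines F & forall x' y',
    point x' y' \in four_line_set C -> point x' y' \in L -> x' = 1 /\ y' = 0.
  have [L L_line LP] := oblique_line 1 (-1 : F).
  exists L => // x' y'; rewrite LP in_four_line_set => + /eqP x'E.
  case/or4P=>
    [/andP[/eqP y'0 _] | /andP[/eqP x'0 yC]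
    | /andP[/eqP x'1 _] | /andP[/eqP y'1 x'C]].
  - by rewrite x'E y'0; split; ring.
  - by case/negP: C1; have <- : y' = 1 by rewrite -[LHS]addr0 -x'0 x'E; ring.
  - by have -> : y' = 1 - x' by [rewrite x'E; ring]; rewrite x'1 subrr.
  - by case/negP: C0; move: x'C; rewrite x'E y'1 mulr1 subrr invr0.
rewrite in_four_line_set.
case/or4P=>
  [/andP[/eqP-> x0] | /andP[/eqP-> yC]
  | /andP[/eqP-> yC] | /andP[/eqP-> xC]].
- have [-> // | x1] := eqVneq x 1.
  have [xC | xC] := boolP (x^-1 \in C); last first.
    have [L L_line LP] := oblique_line x 0.
    exists L => // x' y';
      rewrite LP in_four_line_set mul0r addr0 => /[swap] /eqP->.
    by rewrite (negbTE x0) (negbTE x1) (negbTE xC) andbF !orbF andbT => /eqP.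
  have [e [e0 eC e1 e2]] := C_tangent _ xC.
  have [L L_line LP] := oblique_line x (- x / e).
  exists L => // x' y'; rewrite LP in_four_line_set => + /eqP x'E.
  case/or4P=>
    [/andP[/eqP y'0 _] | /andP[/eqP x'0 yC]
    | /andP[/eqP x'1 yC] | /andP[/eqP y'1 x'C]].
  + by rewrite x'E y'0; split; ring.
  + case/negP: eC; suff <- : y' = e by [].
    have : x' * e / x = 0 by rewrite x'0 !mul0r.
    by rewrite x'E => /eqP; have -> : (x + - x / e * y') * e / x = e - y' by
      [field; rewrite x0 e0]; rewrite subr_eq0 => /eqP.
  + case/negP: yC; suff -> : y' = e * (1 - x^-1) by [].
    have -> : y' = e * (1 - x' / x) by rewrite x'E; field; rewrite x0 e0.
    by rewrite x'1 mul1r.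
  (* For [e = 1] the identity persists, both sides being 0 by the convention [0^-1 = 0]. *)
  + case/negP: e2; suff <- : x'^-1 = x^-1 * e / (e - 1) by [].
    rewrite x'E y'1 mulr1.
    have -> : x + - x / e = x * ((e - 1) / e) by field.
    by rewrite invfM invf_div mulrA.
- have [L L_line LP] := horizontal_line y.
  exists L => // x' y'; rewrite LP in_four_line_set => /[swap] /eqP->.
  have y0 : y != 0 by apply: contraNneq C0 => <-.
  have y1 : y != 1 by apply: contraNneq C1 => <-.
  by rewrite (negbTE y0) (negbTE y1) yC andbF !orbF andbT => /eqP.
- have [-> // | y0] := eqVneq y 0.
  have [L L_line LP] := oblique_line 0 y^-1.
  exists L => // x' y'; rewrite LP add0r in_four_line_set => + /eqP x'E.
  case/or4P=>
    [/andP[/eqP y'0] | /andP[/eqP x'0 y'C]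
    | /andP[/eqP x'1 _] | /andP[/eqP y'1 x'C]].
  + by rewrite x'E y'0 mulr0 eqxx.
  + case/negP: C0; suff <- : y' = 0 by [].
    by apply/eqP; move/eqP: x'0; rewrite x'E mulf_eq0 invr_eq0 (negbTE y0).
  + by split=> //; rewrite -[LHS](mulVKf y0) -x'E x'1 mulr1.
  + by move: x'C; rewrite x'E y'1 mulr1 invrK (negbTE yC).
have [L L_line LP] := oblique_line 0 x.
have x0 : x != 0 by apply: contraNneq C0 => x0; rewrite -(invr0 F) -x0.
exists L => // x' y'; rewrite LP add0r in_four_line_set => + /eqP x'E.
case/or4P=>
  [/andP[/eqP y'0] | /andP[/eqP x'0 y'C]
  | /andP[/eqP x'1 yC] | /andP[/eqP y'1 _]].
- by rewrite x'E y'0 mulr0 eqxx.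
- case/negP: C0; suff <- : y' = 0 by [].
  by apply/eqP; move/eqP: x'0; rewrite x'E mulf_eq0 (negbTE x0).
- case/negP: yC; suff -> : y' = x^-1 by [].
  by rewrite -[LHS](mulKf x0) -x'E x'1 mulr1.
- by rewrite x'E y'1 mulr1.
Qed.

(** * Choice of the set of field elements *)

(** The orbits are pairs and are added one at a time: if [x] lies outside the closed set [C], so
    does [f x]. *)
Lemma involution_closed_subset (T : finType) (f : T -> T) (A : {set T}) n :
  involutive f -> {in A, forall x, f x \in A} -> {in A, forall x, f x != x} ->
  (n.*2 <= #|A|)%N ->
  exists C : {set T},
    [/\ C \subset A, {in C, forall x, f x \in C} & #|C| = n.*2].
Proof.
move=> fK fA f_neq; elim: n => [_ | n IHn n_le].
  by exists set0; split; rewrite ?sub0set ?cards0 // => x; rewrite inE.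
have [C [CA fC cardC]] := IHn (ltnW (ltnW n_le)).
have [/eqP | [x]] := set_0Vmem (A :\: C).
  rewrite setD_eq0 => /subset_leq_card; rewrite cardC leqNgt.
  by rewrite (leq_trans _ n_le) // ltnW.
case/setDP=> xA xC; exists (x |: (f x |: C)); split.
- by rewrite !subUset !sub1set xA fA.
- move=> y; rewrite !inE => /or3P[/eqP-> | /eqP-> | /fC->].
  + by rewrite eqxx orbT.
  + by rewrite fK eqxx.
  + by rewrite !orbT.
have fxC : f x \notin C by apply: contra xC => /fC; rewrite fK.
by rewrite !cardsU1 !inE negb_or eq_sym f_neq // xC fxC cardC.
Qed.

(* For e = 1 the last condition reads 0 \notin C, because 0^-1 = 0. *)
Lemma exists_tangential_set (F : finFieldType) q m :
  #|F| = q -> (0 < m)%N -> (m + 4 <= q)%N ->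
  exists C : {set F}, [/\ 0 \notin C, 1 \notin C, #|C| = m &
    forall w, w \in C -> exists e,
     [/\ e != 0, e \notin C, e * (1 - w) \in C & w * e / (e - 1) \notin C]].
Proof.
move=> cardF m_gt0 m_le.
have avoid (s : seq F) : (size s < q)%N -> exists x, x \notin s.
  rewrite -cardF => s_small; apply/existsP; apply: contraTT s_small.
  rewrite negb_exists -leqNgt => /forallP s_full.
  apply: leq_trans (card_size s); apply: subset_leq_card.
  by apply/subsetP=> x _; have := s_full x; rewrite negbK.
have card_avoid (s : seq F) : (q - size s <= #|~: [set x in s]|)%N.
  by rewrite cardsCs setCK -cardF leq_sub2l // cardsE card_size.
pose f (x : F) := 1 - x.
have fK : involutive f by move=> x; rewrite /f; ring.
have closed_tangent (C : {set F}) w : 0 \notin C -> 1 \notin C ->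
    f w \in C -> exists e,
    [/\ e != 0, e \notin C, e * (1 - w) \in C & w * e / (e - 1) \notin C].
  move=> C0 C1 fwC; exists 1.
  by rewrite oner_eq0 C1 mul1r subrr invr0 mulr0 C0.
have [m1 | m_neq1] := eqVneq m 1%N.
  have [w] : exists w : F, w \notin [:: 0; 1] by apply: avoid => /=; lia.
  rewrite !inE negb_or => /andP[w0 w1]; exists [set w].
  rewrite cards1 !inE ![_ == w]eq_sym w0 w1; split=> // _ /set1P->.
  have w1' : 1 - w != 0 by rewrite subr_eq0 eq_sym.
  have ew : w / (1 - w) - w = w * w / (1 - w) by field.
  have ew' : w / (1 - w) != w by rewrite -subr_eq0 ew !mulf_neq0 ?invr_eq0.
  (* With [C] reduced to [w], this [e] is forced by e (1 - w) = w. *)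
  exists (w / (1 - w)); rewrite !inE; split=> //.
  - by rewrite mulf_neq0 ?invr_eq0.
  - by rewrite divfK.
  have [-> | e1] := eqVneq (w / (1 - w)) 1.
    by rewrite subrr invr0 mulr0 eq_sym.
  rewrite -subr_eq0 in e1; rewrite -subr_eq0.
  have -> : w * (w / (1 - w)) / (w / (1 - w) - 1) - w = w / (w / (1 - w) - 1).
    rewrite -mulrA -[X in _ - X]mulr1 -mulrBr; congr (_ * _).
    by rewrite -[X in _ - X](divff e1) -mulrBl opprB addrCA subrr addr0 mul1r.
  by rewrite mulf_neq0 ?invr_eq0.
(* The list [s] holds the elements kept out of [C], among them all fixed points of [f], so that [f]
   pairs off the rest. *)
have pairs (s : seq F) n : 0 \in s -> 1 \in s -> {in s, forall x, f x \in s} ->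
    (forall x, x \notin s -> f x != x) -> (size s + n.*2 <= q)%N ->
    exists C : {set F}, [/\ {in s, forall x, x \notin C},
      {in C, forall x, f x \in C} & #|C| = n.*2].
  move=> s0 s1 fs f_neq n_le.
  have [||| C [CA fC cardC]] :=
    @involution_closed_subset _ f (~: [set x in s]) n fK.
  - by move=> x; rewrite !inE; apply: contra => /fs; rewrite fK.
  - by move=> x; rewrite !inE => /f_neq.
  - by apply: leq_trans (card_avoid s); lia.
  exists C; split=> // x xs; apply/negP=> /(subsetP CA).
  by rewrite !inE xs.
have m_half : m = (odd m + m./2.*2)%N by rewrite odd_double_half.
have [F2 | F2] := eqVneq (2%:R : F) 0; last first.
  (* The only fixed point of [f] is 1/2; it is kept out of [C] and added back when [m] is odd. *)
  pose h : F := 2^-1.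
  have fh : f h = h by rewrite /f /h; field.
  have [||||| C [sC fC cardC]] := pairs [:: 0; 1; h] m./2.
  - by rewrite !inE eqxx.
  - by rewrite !inE eqxx orbT.
  - move=> x; rewrite !inE => /or3P[]/eqP->;
      rewrite ?fh /f ?subr0 ?subrr ?eqxx ?orbT //.
  - move=> x; rewrite !inE !negb_or => /and3P[_ _]; apply: contra => /eqP fx.
    by apply/eqP; apply: (mulfI F2);
      rewrite /h divff // mulr_natl mulr2n -{1}fx subrK.
  - by rewrite /=; lia.
  have [C0 C1 hC] : [/\ 0 \notin C, 1 \notin C & h \notin C].
    by split; apply: sC; rewrite !inE eqxx ?orbT.
  have h0 : h != 0 by rewrite invr_eq0.
  have h1 : h != 1.
    by apply: contra_neq h0 => h1; rewrite -fh h1 /f subrr.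
  have [m_odd | m_even] := boolP (odd m); last first.
    exists C; split=> [||| w /fC]; rewrite ?cardC //;
      last exact: closed_tangent.
    by rewrite [RHS]m_half (negbTE m_even).
  have D0 : 0 \notin h |: C by rewrite !inE negb_or eq_sym h0.
  have D1 : 1 \notin h |: C by rewrite !inE negb_or eq_sym h1.
  exists (h |: C); split=> // [| w].
    by rewrite cardsU1 hC cardC [RHS]m_half m_odd.
  rewrite !inE => wD; apply: closed_tangent; rewrite // !inE.
  by case/orP: wD => [/eqP-> | /fC->]; rewrite ?fh ?eqxx ?orbT.
have oppF (x : F) : - x = x.
  by apply/eqP; rewrite eq_sym -addr_eq0 -mulr2n -mulr_natl F2 mul0r.
have fE x : f x = x + 1 by rewrite /f oppF addrC.
have f_neq x : f x != x.
  by rewrite fE -subr_eq0 addrC addKr oner_eq0.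
have [m_odd | m_even] := boolP (odd m); last first.
  have [||||| C [sC fC cardC]] := pairs [:: 0; 1] m./2.
  - by rewrite !inE eqxx.
  - by rewrite !inE eqxx orbT.
  - move=> x; rewrite !inE => /orP[]/eqP->;
      rewrite /f ?subr0 ?subrr ?eqxx ?orbT //.
  - by move=> x _; exact: f_neq.
  - by rewrite /=; lia.
  have [C0 C1] : 0 \notin C /\ 1 \notin C.
    by split; apply: sC; rewrite !inE eqxx ?orbT.
  exists C; split=> [||| w /fC]; rewrite ?cardC //; last exact: closed_tangent.
  by rewrite [RHS]m_half (negbTE m_even).
(* These conditions make s + 1, s^2 and s^2 + 1 distinct from each other and from 0, 1 and s. *)
have [s [s0 s1 ss]] : exists s : F, [/\ s != 0, s != 1 & s * s != f s].
  have [s] : exists s : F, s \notin [:: 0; 1] by apply: avoid => /=; lia.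
  rewrite !inE negb_or => /andP[s0 s1].
  have [ss | ss] := eqVneq (s * s) (f s); last by exists s.
  (* If s solves X^2 = X + 1, the solutions are s and s + 1 alone, so any other [r] outside 0 and 1
     will do. *)
  have [r] : exists r : F, r \notin [:: 0; 1; s; f s].
    by apply: avoid => /=; lia.
  rewrite !inE !negb_or => /and4P[r0 r1 rs rfs]; exists r; split=> //.
  rewrite -subr_eq0; have -> : r * r - f r = (r - s) * (r - f s).
    transitivity (r * r - (r + 1) - (s * s - (s + 1))); last by rewrite /f;
      ring.
    by rewrite -!fE ss subrr subr0.
  by rewrite mulf_neq0 ?subr_eq0.
(* Six elements are set aside and three of them return in [D], which leaves m - 3, an even number,
   for [C]. *)
have [||||| C [sC fC cardC]] :=
    pairs [:: 0; 1; s; f s; s * s; f (s * s)] (m - 3)./2.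
- by rewrite !inE eqxx.
- by rewrite !inE eqxx orbT.
- move=> x; rewrite !inE.
  by do 5?[case/orP]; move/eqP->; rewrite ?fK /f ?subr0 ?subrr ?eqxx ?orbT.
- by move=> x _; exact: f_neq.
- by rewrite /=; lia.
have [C0 C1 C2 C3 C4] : [/\ 0 \notin C, 1 \notin C, s \notin C, f s \notin C &
   (s * s \notin C) && (f (s * s) \notin C)].
  by split; rewrite ?sC // !inE eqxx ?orbT.
have {C4} [C4 C5] := andP C4.
have ss0 : s * s != 0 by rewrite mulf_neq0.
have f_inj := can_inj fK.
have f0 x : (0 == f x) = (x == 1) 
  by rewrite eq_sym -[RHS](inj_eq f_inj) [f 1]subrr.
have f1 x : (1 == f x) = (x == 0) 
  by rewrite eq_sym -[RHS](inj_eq f_inj) [f 0]subr0.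
have ss1 : s * s != 1.
  rewrite -subr_eq0; have -> : s * s - 1 = (s - 1) * (s - - 1) by ring.
  by rewrite (oppF (- 1)) mulf_neq0 ?subr_eq0.
have sss : s * s != s
  by rewrite -subr_eq0 -{3}(mulr1 s) -mulrBr mulf_neq0 ?subr_eq0.
have sfss : f (s * s) != s by rewrite (can2_eq fK fK).
(* Only [f s] has its partner outside [D], so every other element can use [e = 1]. *)
pose D := f s |: (s * s |: (f (s * s) |: C)).
have D0 : 0 \notin D.
  by rewrite !inE !negb_or !f0 s1 ss1 C0 eq_sym ss0.
have D1 : 1 \notin D.
  by rewrite !inE !negb_or !f1 s0 ss0 C1 eq_sym ss1.
have Ds : s \notin D.
  by rewrite !inE !negb_or eq_sym f_neq eq_sym sss eq_sym sfss C2.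
exists D; split=> // [| w].
  have e1 : f s != s * s by rewrite eq_sym.
  have e2 : f s != f (s * s) by apply: contra_neq sss => /f_inj.
  have e3 : s * s != f (s * s) by rewrite eq_sym f_neq.
  have half_m3 : (3 + (m - 3)./2.*2)%N = m.
    have m_ge3 : (2 < m)%N
      by case: m m_gt0 m_neq1 m_odd {m_le m_half cardC} => [|[|[|]]].

      by rewrite -[RHS](subnKC m_ge3) -[(m - 3)%N in RHS]odd_double_half oddB //
        m_odd.
  by rewrite !cardsU1 !inE !negb_or e1 e2 e3 C3 C4 C5 cardC -[RHS]half_m3.
rewrite !inE => /or4P[/eqP-> | /eqP-> | /eqP-> | /fC wC]; last first.
- by apply: closed_tangent; rewrite // !inE wC !orbT.
- by apply: closed_tangent; rewrite // !inE fK eqxx !orbT.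
- by apply: closed_tangent; rewrite // !inE eqxx !orbT.
(* For w = s + 1 and e = s, e (1 - w) = s^2 lies in [D], while w e / (e - 1) = s because s - 1 = s +
   1. *)
exists s; split=> //.
  have -> : 1 - f s = s by exact: fK.
  by rewrite !inE eqxx orbT.
have -> : f s * s / (s - 1) = s; last by [].
have fs : f s = s - 1 by rewrite fE -[X in s + X]oppF.
by rewrite fs mulrAC divff ?mul1r ?subr_eq0.
Qed.

(* Realising every size in the range *)
Local Close Scope ring_scope.

Theorem theorem4p5 (p h q : nat) (p_prime : prime p) (h_gt0 : 0 < h)
    (q_def : q = p ^ h) (q_ge5 : 5 <= q)
    (F : finFieldType) (cardF : #|F| = q)
    (k : nat) (k_ge : 2 * q - 1 <= k) (k_le : k <= 3 * q - 6) :
  exists B : {set 'rV[F]_2}, minimal_blocking_set B /\ #|B| = k.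
Proof.
(* Solving 2q - 2 + m = k for m; the bounds on [k] become 1 <= m <= q - 4. *)
have [|||C [C0 C1 cardC C_tangent]] :=
  @exists_tangential_set F q (k + 2 - 2 * q).
- exact: cardF.
- by lia.
- by lia.
exists (four_line_set C); split; last first.
  by rewrite card_four_line_set // cardC cardF; lia.
by apply: four_line_set_minimal; rewrite // -card_gt0 cardC; lia.
Qed.
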